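(* Let $G$ be a snark with colouring defect $\mathrm{df}(G)=3$. If $G$ contains a hexagonal core that intersects a triangle (shares at least one vertex with a triangle of $G$), then $\pi(G)=4$.
   Context: Graphs are finite; loops and multiple edges are allowed. A snark is a $2$-connected cubic graph with no proper $3$-edge-colouring. A $3$-array of a bridgeless cubic graph $H$ is a set of three perfect matchings of $H$; an edge is uncovered if it lies in none of them and simply covered if in exactly one. The colouring defect $\mathrm{df}(H)$ is the minimum number of uncovered edges over all $3$-arrays; a $3$-array attaining this minimum is optimal. The core of a $3$-array is the subgraph formed by all edges that are not simply covered. If $\mathrm{df}(H)=3$, the core of every optimal $3$-array is an induced $6$-cycle, called a hexagonal core. The perfect matching index $\pi(G)$ is the smallest number of perfect matchings of $G$ whose union is $E(G)$. *)

(* Defs.v *)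
(* Finite multigraphs (loops and parallel edges allowed):
   a vertex type V, an edge type E (both finite), and two endpoint maps
   src tgt : E -> V.  An edge e is a loop iff src e = tgt e. *)
From mathcomp Require Import all_boot.
Set Implicit Arguments. Unset Strict Implicit. Unset Printing Implicit Defensive.

Section Multigraph.
Variables (V E : finType) (src tgt : E -> V).

Definition inc (v : V) (e : E) : bool := (src e == v) || (tgt e == v).

Definition is_loop (e : E) : bool := src e == tgt e.

(* degree: number of edge-ends at v (a loop counts twice) *)
Definition degree (v : V) : nat :=
  #|[set e | src e == v]| + #|[set e | tgt e == v]|.

Definition cubic : Prop := forall v, degree v = 3.

Definition adj : rel V :=
  fun x y => (x != y) && [exists e, ((src e == x) && (tgt e == y)) ||
                                    ((src e == y) && (tgt e == x))].

Definition connected : Prop := forall x y, connect adj x y.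

Definition adj_minus (v : V) : rel V :=
  fun x y => [&& adj x y, x != v & y != v].

Definition two_connected : Prop :=
  [/\ 2 < #|V|, connected &
      forall v x y, x != v -> y != v -> connect (adj_minus v) x y].

(* proper edge colouring with 3 colours (loops admit no proper colouring) *)
Definition three_edge_colourable : Prop :=
  exists c : E -> 'I_3,
    (forall e, ~~ is_loop e) /\
    (forall e f, e != f -> (exists v, inc v e && inc v f) -> c e != c f).

Definition snark : Prop :=
  [/\ two_connected, cubic & ~ three_edge_colourable].

Definition perfect_matching (M : {set E}) : Prop :=
  (forall e, e \in M -> ~~ is_loop e) /\
  (forall v, #|[set e in M | inc v e]| = 1).

Definition three_array (M1 M2 M3 : {set E}) : Prop :=
  [/\ perfect_matching M1, perfect_matching M2 & perfect_matching M3].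

Definition cover_count (M1 M2 M3 : {set E}) (e : E) : nat :=
  (e \in M1) + (e \in M2) + (e \in M3).

Definition uncovered (M1 M2 M3 : {set E}) : {set E} :=
  [set e | cover_count M1 M2 M3 e == 0].

Definition colouring_defect_is (k : nat) : Prop :=
  (exists M1 M2 M3, three_array M1 M2 M3 /\ #|uncovered M1 M2 M3| = k) /\
  (forall M1 M2 M3, three_array M1 M2 M3 -> k <= #|uncovered M1 M2 M3|).

Definition optimal_array (M1 M2 M3 : {set E}) : Prop :=
  three_array M1 M2 M3 /\
  forall N1 N2 N3, three_array N1 N2 N3 ->
    #|uncovered M1 M2 M3| <= #|uncovered N1 N2 N3|.

Definition core_edges (M1 M2 M3 : {set E}) : {set E} :=
  [set e | cover_count M1 M2 M3 e != 1].

Definition core_vertices (M1 M2 M3 : {set E}) : {set V} :=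
  [set v | [exists e in core_edges M1 M2 M3, inc v e]].

Definition triangle (a b c : V) : Prop :=
  [/\ adj a b, adj b c & adj a c].

Definition covered_by_pms (k : nat) : Prop :=
  exists Ms : 'I_k -> {set E},
    (forall i, perfect_matching (Ms i)) /\
    (forall e, exists i, e \in Ms i).

Definition pm_index_is (k : nat) : Prop :=
  covered_by_pms k /\ forall j, j < k -> ~ covered_by_pms j.

End Multigraph.

(* Main.v *)
(* Deleting the edges of the hexagonal core from an optimal array leaves a
   3-edge-coloured graph in which the edges leaving the hexagon have colours
   0,0,1,1,2,2 in cyclic order; equal colours sit at the ends of the doubly
   covered edges.  A triangle meeting the core must consist of an uncovered edge
   and two leaving edges of different colours, say 0 and 1, with a common end x
   outside the hexagon.  As the graph has no three perfect matchings covering all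
   edges, no recolouring may extend to the hexagon; this determines how two
   successive Kempe chains pair up the leaving edges (in the second step one
   also uses that the colours of the two edges at x can be exchanged), and after
   switching both chains colour 1 does not leave the hexagon at all.  That
   colour class together with the three uncovered edges is a fourth perfect
   matching completing the optimal array to a cover. *)
Require Import Defs.
From mathcomp Require Import all_boot zify.

Set Implicit Arguments.
Unset Strict Implicit.
Unset Printing Implicit Defensive.

(** * Degrees in edge sets and Kempe chains *)

Section Degree.

Variables (V E : finType) (src tgt : E -> V).
Hypothesis noloop : forall e, ~~ is_loop src tgt e.

Local Notation inc := (inc src tgt).

Definition deg (X : {set E}) (v : V) := #|[set e in X | inc v e]|.

Lemma degE X v : deg X v = \sum_(e in X) inc v e.
Proof.
rewrite /deg -sum1_card big_mkcond [RHS]big_mkcond /=.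
by apply: eq_bigr => e _; rewrite inE; case: (e \in X) => //; case: (inc v e).
Qed.

Lemma deg_setU1 (X : {set E}) e v : e \notin X -> deg (e |: X) v = inc v e + deg X v.
Proof. by move=> eX; rewrite !degE big_setU1. Qed.

Lemma deg_setD1 (X : {set E}) e v : e \in X -> deg X v = inc v e + deg (X :\ e) v.
Proof. by move=> eX; rewrite !degE (big_setD1 e). Qed.

Lemma deg_setU (X Y : {set E}) v : [disjoint X & Y] -> deg (X :|: Y) v = deg X v + deg Y v.
Proof.
move=> dXY; rewrite !degE -bigU //=.
by apply: eq_bigl => e; rewrite !inE.
Qed.

Lemma deg_setD (X Y : {set E}) v : Y \subset X -> deg X v = deg Y v + deg (X :\: Y) v.
Proof. by move=> /setIidPr sYX; rewrite !degE (big_setID Y) /= sYX. Qed.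

Lemma deg_gt0 (X : {set E}) e v : e \in X -> inc v e -> 0 < deg X v.
Proof. by move=> eX ev; rewrite (deg_setD1 v eX) ev. Qed.

Lemma deg_gt0_ex X v : 0 < deg X v -> exists2 e, e \in X & inc v e.
Proof. by case/card_gt0P=> e; rewrite inE => /andP[]; exists e. Qed.

Lemma deg_le1_uniq X v e f : deg X v <= 1 ->
  e \in X -> inc v e -> f \in X -> inc v f -> e = f.
Proof.
move=> d1 eX ev fX fv; apply/eqP/negPn/negP => nef.
move: d1; rewrite (deg_setD1 v eX) ev.
have : f \in X :\ e by rewrite !inE fX eq_sym nef.
by move/deg_gt0/(_ fv); lia.
Qed.

Lemma other_end v e : inc v e ->
  exists2 w, w != v & forall x, inc x e = (x == v) || (x == w).
Proof.
have := noloop e; rewrite /is_loop /inc => nl /orP[]/eqP ev.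
  exists (tgt e) => [|x]; first by rewrite -ev eq_sym.
  by rewrite -ev ![_ == x]eq_sym.
exists (src e) => [|x]; first by rewrite -ev.
by rewrite -ev ![_ == x]eq_sym orbC.
Qed.

(* Peel off the edge at the end of the chain and recurse from its other end. *)
Lemma kempe_chain X Y v :
  (forall x, deg X x <= 1) -> (forall x, deg Y x <= 1) ->
  deg X v = 0 -> deg Y v = 1 ->
  exists w X' Y',
    [/\ w != v, deg X w + deg Y w = 1, X' :|: Y' = X :|: Y,
        forall x, deg X' x = if x \in [:: v; w] then deg Y x else deg X x &
        forall x, deg Y' x = if x \in [:: v; w] then deg X x else deg Y x].
Proof.
have [n] := ubnP (#|X| + #|Y|); elim: n X Y v => // n IHn X Y v ltn X1 Y1 Xv Yv.
have [|e eY ev] := @deg_gt0_ex Y v; first by rewrite Yv.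
have eX : e \notin X by apply/negP => eX; have := deg_gt0 eX ev; rewrite Xv.
have [w nwv incE] := other_end ev.
have DY x := deg_setD1 x eY.
have incv : inc v e = true by rewrite incE eqxx.
have incw : inc w e = true by rewrite incE eqxx orbT.
(* If no edge of [X] continues the chain at [w], the chain is [e] alone, and [e] changes sides. *)
case Xw: (deg X w) => [|k].
  exists w, (e |: X), (Y :\ e); split=> //.
  - by have := DY w; have := Y1 w; rewrite incw Xw; lia.
  - by apply/setP => f; rewrite !inE; case: eqP => // ->; rewrite eY orbT.
  - move=> x; rewrite deg_setU1 // !inE; have := DY x; have := Y1 x.
    rewrite incE; case: (eqVneq x v) => [->|_] /=; first by rewrite Xv; lia.
    by case: (eqVneq x w) => [->|_] /=; rewrite ?Xw; lia.
  move=> x; rewrite !inE; have := DY x; have := Y1 x.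
  rewrite incE; case: (eqVneq x v) => [->|_] /=; first by rewrite Xv; lia.
  by case: (eqVneq x w) => [->|_] /=; rewrite ?Xw; lia.
(* Otherwise the chain goes on from [w] with the roles of the two sets exchanged. Adding [e] to [B]
   afterwards brings [w] back to degree 1. *)
have [|||||x [A [B [nxw xl eAB dA dB]]]] := IHn (Y :\ e) X w.
- by move: ltn; rewrite (cardsD1 e Y) eY; lia.
- by move=> x; have := Y1 x; rewrite DY; lia.
- by [].
- by have := DY w; have := Y1 w; rewrite incw; lia.
- by have := X1 w; lia.
have nxv : x != v.
  apply/eqP => exv; move: xl; rewrite exv Xv.
  by have := DY v; rewrite incv; lia.
have eB : e \notin B.
  apply/negP => eB; have : e \in A :|: B by rewrite inE eB orbT.
  by rewrite eAB !inE eqxx (negPf eX).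
exists x, (e |: B), A; split=> //.
- by have := DY x; rewrite incE (negPf nxv) (negPf nxw) /=; lia.
- have /setP eqAB := eAB; apply/setP => f; have := eqAB f; rewrite !inE.
  case: eqP => [->|_] /=; first by rewrite eY orbT.
  by rewrite orbC => ->; rewrite orbC.
- move=> y; rewrite deg_setU1 // dB !inE; have := DY y; rewrite incE.
  have [->|nyv] := eqVneq y v.
    by rewrite ![v == _]eq_sym (negPf nwv) (negPf nxv) /= Xv; lia.
  have [->|nyw] := eqVneq y w => /=.
    by rewrite eq_sym (negPf nxw); have := Y1 w; rewrite Xw; have := X1 w; lia.
  by case: (y == x); lia.
move=> y; rewrite dA !inE; have := DY y; rewrite incE.
have [->|nyv] := eqVneq y v.
  by rewrite ![v == _]eq_sym (negPf nwv) (negPf nxv) /= Xv; lia.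
have [->|nyw] := eqVneq y w => /=.
  by rewrite eq_sym (negPf nxw); have := Y1 w; have := X1 w; lia.
by case: (y == x); lia.
Qed.

End Degree.

(** * Colourings outside a hexagon *)

Section Hexagon.

Variables (V E : finType) (src tgt : E -> V).
Hypothesis noloop : forall e, ~~ is_loop src tgt e.

Local Notation inc := (inc src tgt).
Local Notation deg := (deg src tgt).

Variables (u : nat -> V) (h : nat -> E).
Hypothesis u_inj : forall j k, j < 6 -> k < 6 -> u j = u k -> j = k.
Hypothesis inc_h :
  forall k, k < 6 -> forall x, inc x (h k) = (x == u k) || (x == u (k.+1 %% 6)).

Definition hexagon_edges (B : pred nat) : {set E} := [set h k | k : 'I_6 & B k].

Lemma hexagon_edgesP (B : pred nat) e :
  reflect (exists k, [/\ k < 6, B k & e = h k]) (e \in hexagon_edges B).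
Proof.
apply: (iffP imsetP) => [[k]|[k [k6 Bk ->]]].
  by rewrite inE => Bk ->; exists k.
by exists (Ordinal k6); rewrite ?inE.
Qed.

Lemma eq_u j k : j < 6 -> k < 6 -> (u j == u k) = (j == k).
Proof.
by move=> j6 k6; apply/eqP/eqP => [/u_inj->|->].
Qed.

Lemma h_inj j k : j < 6 -> k < 6 -> h j = h k -> j = k.
Proof.
move=> j6 k6 ejk; have := inc_h j6 (u j); have := inc_h j6 (u (j.+1 %% 6)).
rewrite ejk !inc_h // !eq_u ?ltn_mod // !eqxx orbT /=; lia.
Qed.

Lemma deg_hexagon_edgesE (B : pred nat) v :
  deg (hexagon_edges B) v = \sum_(k < 6) B k * inc v (h k).
Proof.
rewrite degE /hexagon_edges big_imset /=; last first.
  by move=> j k _ _ /h_inj ejk; apply/val_inj/ejk.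
rewrite big_mkcond /=; apply: eq_bigr => k _.
by rewrite inE; case: (B k); rewrite ?mul1n ?mul0n.
Qed.

Lemma deg_hexagon_edges (B : pred nat) k : k < 6 ->
  deg (hexagon_edges B) (u k) = B k + B ((k + 5) %% 6).
Proof.
move=> k6; rewrite deg_hexagon_edgesE.
under eq_bigr => j _ do rewrite inc_h // !eq_u ?ltn_mod //.
rewrite !big_ord_recl big_ord0.
by move: k k6; do 6?[case=> [|] //]; rewrite /= ?muln1 ?muln0 ?addn0 ?add0n //;
   rewrite addnC.
Qed.

Lemma deg_hexagon_edges_out (B : pred nat) v :
  (forall k, k < 6 -> v != u k) -> deg (hexagon_edges B) v = 0.
Proof.
move=> vu; rewrite deg_hexagon_edgesE big1 // => k _.
by rewrite inc_h // !(negPf (vu _ _)) ?ltn_mod ?muln0.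
Qed.

(* [X 0], [X 1], [X 2] are the colour classes of a proper 3-edge-colouring of
   the graph minus the hexagon edges, and [nth 0 p k] is the colour of the edge
   that leaves the hexagon at [u k]. *)
Definition outer_colouring (X : nat -> {set E}) (p : seq nat) : Prop :=
  [/\ forall i k, i < 3 -> k < 6 -> deg (X i) (u k) = (nth 0 p k == i),
      forall i v, i < 3 -> (forall k, k < 6 -> v != u k) -> deg (X i) v = 1,
      forall i k, i < 3 -> k < 6 -> h k \notin X i &
      forall e, (forall k, k < 6 -> e != h k) -> exists2 i, i < 3 & e \in X i].

(** The leaving colours after a Kempe switch whose chain ends at positions [k] and [l], where the
    old colours should be [i] or [j]. Tabulation by [mkseq] lets concrete patterns compute. *)
Definition swap_at (p : seq nat) (i j k l : nat) : seq nat :=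
  mkseq (fun m => let c := nth 0 p m in
                  if m \in [:: k; l] then (if c == i then j else i) else c) 6.

Lemma vertex_hexagonP v :
  (exists2 k, k < 6 & v = u k) \/ (forall k, k < 6 -> v != u k).
Proof.
have [/hasP[k]|/hasPn nk] := boolP (has (fun k => v == u k) (iota 0 6)).
  by rewrite mem_iota => k6 /eqP->; left; exists k.
by right=> k k6; apply: nk; rewrite mem_iota.
Qed.

Lemma outer_colouring_deg_le1 X p i v :
  outer_colouring X p -> i < 3 -> deg (X i) v <= 1.
Proof.
case=> Xu Xv _ _ i3; have [[k k6 ->]|nv] := vertex_hexagonP v.
  by rewrite Xu // leq_b1.
by rewrite Xv.
Qed.

(** Off the hexagon every vertex has one edge of each colour, so a chain in colours [i] and [j]
    cannot stop there. The chain from [u k] returns to the hexagon at some [u l], and its switch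
    alters the pattern only at these two ends. *)
Lemma outer_colouring_kempe X p i j k :
  outer_colouring X p -> i < 3 -> j < 3 -> i != j -> k < 6 -> nth 0 p k = i ->
  exists l X', [/\ l < 6, l != k, nth 0 p l \in [:: i; j] &
                   outer_colouring X' (swap_at p i j k l)].
Proof.
move=> cX i3 j3 nij k6 pk; have [Xu Xv Xh XE] := cX.
have [||||w [A [B [nwk wl eAB dA dB]]]] :=
  @kempe_chain _ _ src tgt noloop (X j) (X i) (u k).
- by move=> x; apply: outer_colouring_deg_le1 cX _.
- by move=> x; apply: outer_colouring_deg_le1 cX _.
- by rewrite Xu // pk (negPf nij).
- by rewrite Xu // pk eqxx.
have [[l l6 ewl]|nw] := vertex_hexagonP w; last by move: wl; rewrite !Xv.
have nlk : l != k by apply: contraNneq nwk => <-; rewrite ewl.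
have pl : nth 0 p l \in [:: i; j].
  by move: wl; rewrite ewl !Xu // !inE; do 2!case: (_ == _).
have inuw m : m < 6 -> (u m \in [:: u k; w]) = (m \in [:: k; l]).
  by move=> m6; rewrite ewl !inE !eq_u.
have notuw v : (forall m, m < 6 -> v != u m) -> (v \in [:: u k; w]) = false.
  by move=> nv; rewrite ewl !inE !(negPf (nv _ _)).
have pkl m : m \in [:: k; l] -> nth 0 p m \in [:: i; j].
  by move: pl; rewrite !inE => pl /orP[]/eqP->; rewrite // pk eqxx.
have nji : (j == i) = false by rewrite eq_sym (negPf nij).
have subAB e : (e \in A) || (e \in B) = (e \in X j) || (e \in X i).
  by have /setP/(_ e) := eAB; rewrite !inE.
exists l, (fun m => if m == j then A else if m == i then B else X m).
split=> //; split.
- move=> m q m3 q6; rewrite nth_mkseq //=; have := pkl q.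
  case: ifP => [/eqP->|/eqP nmj]; first rewrite dA inuw // !Xu //.
    case: ifP => // _ /(_ isT); rewrite !inE => /orP[]/eqP->.
      by rewrite !eqxx.
    by rewrite nji (negPf nij).
  case: ifP => [/eqP->|/eqP nmi]; first rewrite dB inuw // !Xu //.
    case: ifP => // _ /(_ isT); rewrite !inE => /orP[]/eqP->.
      by rewrite eqxx nji (negPf nij).
    by rewrite nji !eqxx.
  rewrite Xu //; case: ifP => // _ /(_ isT); rewrite !inE => /orP[]/eqP->.
    by rewrite eqxx; congr (nat_of_bool _); apply/eqP/eqP; lia.
  by rewrite nji; congr (nat_of_bool _); apply/eqP/eqP; lia.
- move=> m v m3 nv; case: ifP => _; first by rewrite dA notuw // Xv.
  by case: ifP => _; rewrite ?dB ?notuw // Xv.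
- move=> m q m3 q6; have := subAB (h q).
  rewrite !(negPf (Xh _ _ _ _)) //.
  move=> hAB; do 2?case: ifP => _; rewrite ?Xh //;
    by apply/negP => hq; move: hAB; rewrite hq ?orbT.
move=> e /XE[m m3 em]; have := subAB e.
have [emj|nmj] := eqVneq m j.
  rewrite emj in em; rewrite em => /orP[eA|eB]; first by exists j; rewrite ?eqxx.
  by exists i; rewrite ?(negPf nij) ?eqxx.
have [emi|nmi] := eqVneq m i.
  rewrite emi in em; rewrite em orbT => /orP[eA|eB]; first by exists j; rewrite ?eqxx.
  by exists i; rewrite ?(negPf nij) ?eqxx.
by exists m; rewrite ?(negPf nmj) ?(negPf nmi).
Qed.

(** The edges [f] and [g] form a Kempe chain by themselves, from [u a] through [x] to [u b];
    exchanging their colours leaves one edge of each colour at [x]. *)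
Lemma outer_colouring_flip X p i j a b x f g :
  outer_colouring X p -> i < 3 -> j < 3 -> i != j ->
  a < 6 -> b < 6 -> a != b -> nth 0 p a = i -> nth 0 p b = j ->
  (forall k, k < 6 -> x != u k) ->
  (forall y, inc y f = (y == u a) || (y == x)) ->
  (forall y, inc y g = (y == u b) || (y == x)) ->
  exists X', outer_colouring X' (swap_at p i j a b).
Proof.
move=> cX i3 j3 nij a6 b6 nab pa pb nx incf incg; have [Xu Xv Xh XE] := cX.
have nji : (j == i) = false by rewrite eq_sym (negPf nij).
have nhf k : k < 6 -> f != h k.
  move=> k6; apply/eqP => eh; have := incf x.
  by rewrite eh inc_h // eqxx orbT !(negPf (nx _ _)) ?ltn_mod.
have nhg k : k < 6 -> g != h k.
  move=> k6; apply/eqP => eh; have := incg x.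
  by rewrite eh inc_h // eqxx orbT !(negPf (nx _ _)) ?ltn_mod.
have col e k m : inc (u k) e -> k < 6 -> m < 3 -> e \in X m -> nth 0 p k = m.
  move=> ie k6 m3 em; have := deg_gt0 em ie.
  by rewrite Xu //; case: eqP.
have fXi : f \in X i.
  have [m m3 fm] := XE f nhf; rewrite -pa (col f a m) //.
  by rewrite incf eqxx.
have gXj : g \in X j.
  have [m m3 gm] := XE g nhg; rewrite -pb (col g b m) //.
  by rewrite incg eqxx.
have gXi : g \notin X i.
  apply: contra nij => gi; apply/eqP; rewrite -pb (col g b i) //.
  by rewrite incg eqxx.
have fXj : f \notin X j.
  apply: contra nij => fj; apply/eqP; rewrite -pa (col f a j) //.
  by rewrite incf eqxx.
have nua : u a == x = false by rewrite eq_sym (negPf (nx _ _)).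
have nub : u b == x = false by rewrite eq_sym (negPf (nx _ _)).
have di v : deg (g |: X i :\ f) v + inc v f = inc v g + deg (X i) v.
  rewrite deg_setU1 ?(deg_setD1 _ _ _ fXi) ?inE ?negb_and ?gXi ?orbT //; lia.
have dj v : deg (f |: X j :\ g) v + inc v g = inc v f + deg (X j) v.
  rewrite deg_setU1 ?(deg_setD1 _ _ _ gXj) ?inE ?negb_and ?fXj ?orbT //; lia.
exists (fun m => if m == i then g |: X i :\ f else
                 if m == j then f |: X j :\ g else X m).
split.
- move=> m k m3 k6; rewrite nth_mkseq //=.
  have nux : u k == x = false by rewrite eq_sym (negPf (nx _ _)).
  have := di (u k); have := dj (u k); rewrite incf incg nux !orbF !eq_u // !Xu //.
  rewrite !inE.
  have [->|nka] := eqVneq k a.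
    rewrite pa (negPf nab) eqxx /=; have [emi|nmi] := eqVneq m i.
      by rewrite ?emi ?eqxx ?nji ?(negPf nij); lia.
    have [emj|nmj] := eqVneq m j; first by rewrite ?emj ?eqxx ?nji ?(negPf nij); lia.
    by rewrite Xu // pa; lia.
  have [->|nkb] := eqVneq k b => /=.
    rewrite pb eqxx /= nji; have [emi|nmi] := eqVneq m i.
      by rewrite ?emi ?eqxx ?nji ?(negPf nij); lia.
    have [emj|nmj] := eqVneq m j; first by rewrite ?emj ?eqxx ?nji ?(negPf nij); lia.
    by rewrite Xu // pb; lia.
  have [emi|nmi] := eqVneq m i; first by rewrite /= emi; lia.
  have [emj|nmj] := eqVneq m j; first by rewrite /= emj; lia.
  by rewrite Xu.
- move=> m v m3 nv; have := di v; have := dj v; rewrite !Xv // incf incg.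
  rewrite !(negPf (nv _ _)) //=; case: ifP => _; first lia.
  by case: ifP => _; [lia | rewrite Xv].
- move=> m k m3 k6; have := nhf k k6; have := nhg k k6.
  have := Xh i k i3 k6; have := Xh j k j3 k6; have := Xh m k m3 k6.
  rewrite ![_ == h k]eq_sym => ? ? ? ? ?.
  by case: ifP => _; [|case: ifP => _ //]; rewrite !inE negb_or negb_and;
     apply/andP; split=> //; apply/orP; right.
move=> e /XE[m m3 em].
have [->|nef] := eqVneq e f.
  by exists j; rewrite // nji eqxx !inE eqxx.
have [->|neg] := eqVneq e g.
  by exists i; rewrite // eqxx !inE eqxx.
exists m => //; case: eqP => [emi|_].
  by rewrite !inE nef -emi em orbT.
by case: eqP => [emj|_] //; rewrite !inE neg -emj em orbT.
Qed.

(* [nth 0 q k] is the colour of the hexagon edge [h k], which joins [u k] to its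
   cyclic successor; [(k + 5) %% 6] is the cyclic predecessor of [k]. *)
Definition extends_hexagon (p q : seq nat) : bool :=
  all (fun k => (nth 0 q k < 3) && all (fun i =>
    (nth 0 p k == i) + ((nth 0 q k == i) + (nth 0 q ((k + 5) %% 6) == i)) == 1)
    (iota 0 3)) (iota 0 6).

Lemma deg_outer_hexagon (X : {set E}) B v :
  (forall k, k < 6 -> h k \notin X) ->
  deg (X :|: hexagon_edges B) v = deg X v + deg (hexagon_edges B) v.
Proof.
move=> Xh; apply: deg_setU; rewrite disjoint_sym; apply/pred0P => e /=.
by apply/andP => -[/hexagon_edgesP[k [k6 _ ->]]]; apply/negP/Xh.
Qed.

Lemma edge_hexagonP e :
  (exists2 k, k < 6 & e = h k) \/ (forall k, k < 6 -> e != h k).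
Proof.
have [/hexagon_edgesP[k [k6 _ ->]]|nk] := boolP (e \in hexagon_edges xpredT).
  by left; exists k.
right=> k k6; apply: contraNneq nk => ->; apply/hexagon_edgesP.
by exists k.
Qed.

(** Each colour class is completed by the hexagon edges to which [q] gives its colour; the test in
    [extends_hexagon] is the degree count at [u k]. *)
Lemma extends_hexagon_matchings X p q :
  outer_colouring X p -> extends_hexagon p q ->
  exists N : nat -> {set E},
    (forall i, i < 3 -> forall v, deg (N i) v = 1) /\
    (forall e, exists2 i, i < 3 & e \in N i).
Proof.
move=> [Xu Xv Xh XE] /allP ext.
exists (fun i => X i :|: hexagon_edges (fun k => nth 0 q k == i)); split.
  move=> i i3 v; rewrite deg_outer_hexagon => [|k k6]; last exact: Xh.
  have [[k k6 ->]|nv] := vertex_hexagonP v; last first.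
    by rewrite Xv // deg_hexagon_edges_out.
  rewrite Xu // deg_hexagon_edges //; have := ext k.
  rewrite mem_iota => /(_ k6) /andP[_ /allP/(_ i)].
  by rewrite mem_iota => /(_ i3)/eqP.
move=> e; have [[k k6 ->]|/XE[i i3 ei]] := edge_hexagonP e; last first.
  by exists i; rewrite // inE ei.
exists (nth 0 q k); first by have := ext k; rewrite mem_iota => /(_ k6)/andP[].
by rewrite inE; apply/orP; right; apply/hexagon_edgesP; exists k.
Qed.

Hypothesis no_cover : forall N : nat -> {set E},
  (forall i, i < 3 -> forall v, deg (N i) v = 1) ->
  ~ (forall e, exists2 i, i < 3 & e \in N i).

Lemma not_extends_hexagon X p q :
  outer_colouring X p -> extends_hexagon p q -> False.
Proof.
by move=> cX /(extends_hexagon_matchings cX)[N [N1 NE]]; apply: (no_cover N1).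
Qed.

(** Patterns that extend to the hexagon are excluded by [no_cover]. This forces two Kempe chains, in
    colours 1, 2 from [u 2] and then in colours 1, 0 from [u 3], to end at [u 5]; the pattern
    becomes 0,0,2,0,2,0. *)
Lemma outer_matching X x f g :
  outer_colouring X [:: 0; 0; 1; 1; 2; 2] ->
  (forall k, k < 6 -> x != u k) ->
  (forall y, inc y f = (y == u 1) || (y == x)) ->
  (forall y, inc y g = (y == u 2) || (y == x)) ->
  exists X' p, outer_colouring X' p /\ forall k, k < 6 -> nth 0 p k != 1.
Proof.
move=> cX nx incf incg.
(* An end at [u 3] or [u 4] would give 0,0,2,2,2,2 or 0,0,2,1,1,2; both extend by the hexagon
   colours listed. *)
have [l [X1 [l6 + + c1]]] :=
  @outer_colouring_kempe X _ 1 2 2 cX isT isT isT isT erefl.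
move: l l6 c1; do 6?[case=> [|] //] => _.
- move=> c1 _ _; exfalso.
  exact: (@not_extends_hexagon _ _ [:: 2; 1; 0; 1; 0; 1] c1).
- move=> c1 _ _; exfalso.
  exact: (@not_extends_hexagon _ _ [:: 2; 1; 0; 2; 0; 1] c1).
move=> c1 _ _.
(* The pattern is now 0,0,2,1,2,1. An end at [u 0] or [u 1] gives 1,0,2,0,2,1 or 0,1,2,0,2,1.
   Neither extends as it stands, but exchanging the colours at [x] turns them into 1,2,0,0,2,1 and
   0,2,1,0,2,1, which do. *)
have [l [X2 [l6 + + c2]]] :=
  @outer_colouring_kempe _ _ 1 0 3 c1 isT isT isT isT erefl.
move: l l6 c2; do 6?[case=> [|] //] => _.
- move=> c2 _ _; exfalso.
  have [X3 c3] := @outer_colouring_flip _ _ 0 2 1 2 x f g c2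
    isT isT isT isT isT isT erefl erefl nx incf incg.
  exact: (@not_extends_hexagon _ _ [:: 0; 1; 2; 1; 0; 2] c3).
- move=> c2 _ _; exfalso.
  have [X3 c3] := @outer_colouring_flip _ _ 1 2 1 2 x f g c2
    isT isT isT isT isT isT erefl erefl nx incf incg.
  exact: (@not_extends_hexagon _ _ [:: 1; 0; 2; 1; 0; 2] c3).
move=> c2 _ _; exists X2, (swap_at (swap_at [:: 0; 0; 1; 1; 2; 2] 1 2 2 5) 1 0 3 5).
by split=> // k; do 6?[case: k => [|k] //].
Qed.

(* Once no edge of the second class leaves the hexagon, that class completed by
   [h 1], [h 3], [h 5] is a perfect matching. *)
Lemma matching_through_uncovered x f g (X : nat -> {set E}) :
  outer_colouring X [:: 0; 0; 1; 1; 2; 2] ->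
  (forall k, k < 6 -> x != u k) ->
  (forall y, inc y f = (y == u 1) || (y == x)) ->
  (forall y, inc y g = (y == u 2) || (y == x)) ->
  exists N : {set E},
    [/\ forall v, deg N v = 1, h 1 \in N, h 3 \in N & h 5 \in N].
Proof.
move=> cX nx incf incg; have [Y [p [cY np]]] := outer_matching cX nx incf incg.
have [Yu Yv Yh _] := cY.
exists (Y 1 :|: hexagon_edges odd); split.
- move=> v; rewrite deg_outer_hexagon => [|k k6]; last exact: Yh.
  have [[k k6 ->]|nv] := vertex_hexagonP v; last first.
    by rewrite Yv // deg_hexagon_edges_out.
  rewrite Yu // deg_hexagon_edges // (negPf (np _ k6)).
  by move: k k6; do 6?[case=> [|] //].
- by rewrite inE; apply/orP; right; apply/hexagon_edgesP; exists 1.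
- by rewrite inE; apply/orP; right; apply/hexagon_edgesP; exists 3.
- by rewrite inE; apply/orP; right; apply/hexagon_edgesP; exists 5.
Qed.

End Hexagon.

(** * The core of an optimal array *)

Section Core.

Variables (V E : finType) (src tgt : E -> V).
Hypothesis noloop : forall e, ~~ is_loop src tgt e.

Local Notation inc := (inc src tgt).
Local Notation deg := (deg src tgt).

Hypothesis deg3 : forall v, deg setT v = 3.

Variable M : nat -> {set E}.
Hypothesis M1 : forall i, i < 3 -> forall v, deg (M i) v = 1.

Definition cnt (N : nat -> {set E}) := cover_count (N 0) (N 1) (N 2).
Definition unc (N : nat -> {set E}) := uncovered (N 0) (N 1) (N 2).

Hypothesis unc3 : #|unc M| = 3.
Hypothesis unc_min : forall N : nat -> {set E},
  (forall i, i < 3 -> forall v, deg (N i) v = 1) -> 3 <= #|unc N|.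

Lemma uncP (N : nat -> {set E}) e :
  reflect (forall i, i < 3 -> e \notin N i) (e \in unc N).
Proof.
rewrite inE /cover_count !addn_eq0 !eqb0 -andbA.
apply: (iffP and3P) => [[e0 e1 e2] [|[|[|i]]] //|eN].
by split; apply: eN.
Qed.

(** Trading [D] for [Z] in [M i] keeps a perfect matching. The edges of [D] stay covered by other
    matchings and those of [Z] become covered, so fewer than three edges remain uncovered. *)
Lemma alternating_swap i (D Z : {set E}) :
  i < 3 -> D \subset M i ->
  (forall e, e \in D -> exists l, [/\ l < 3, l != i & e \in M l]) ->
  Z \subset unc M -> Z != set0 -> (forall v, deg D v = deg Z v) -> False.
Proof.
move=> i3 sDM Dl sZU Z0 DZ.
have dZ : [disjoint M i :\: D & Z].
  rewrite disjoint_sym; apply/pred0P => e /=; apply/andP => -[eZ].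
  by rewrite inE => /andP[_]; apply/negP/(elimT (uncP M e)) => //; apply: (subsetP sZU).
pose N l := if l == i then M i :\: D :|: Z else M l.
have N1 l : l < 3 -> forall v, deg (N l) v = 1.
  move=> l3 v; rewrite /N; case: ifP => [_|_]; last exact: M1.
  by rewrite deg_setU // -DZ addnC -deg_setD // M1.
have sNM : unc N \subset unc M :\: Z.
  apply/subsetP => e /(uncP N e) eN; have := eN i i3; rewrite /N eqxx in_setU in_setD negb_or.
  case/andP => nD nZ; rewrite in_setD nZ /=; apply/uncP => l l3; apply/negP => el.
  have nl k : k < 3 -> k != i -> e \notin M k.
    by move=> k3 nk; have := eN k k3; rewrite /N (negPf nk).
  have [eli|nli] := eqVneq l i; last by have := nl l l3 nli; rewrite el.
  move: nD; rewrite -eli el andbT negbK => /Dl[k [k3 nk ek]].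
  by have := nl k k3 nk; rewrite ek.
have := unc_min N1; have := subset_leq_card sNM.
have := cardsID Z (unc M); rewrite (setIidPr sZU) unc3.
by move: Z0; rewrite -card_gt0; lia.
Qed.

Lemma inc_pair e p q : p != q -> inc p e -> inc q e ->
  forall x, inc x e = (x == p) || (x == q).
Proof.
move=> npq pe; have [w nwp incE] := other_end noloop pe.
by rewrite incE eq_sym (negPf npq) /= => /eqP-> x.
Qed.

(** If [e] were in all three matchings, the two other edges at each of its ends would be uncovered.
    With only three uncovered edges, one of them joins both ends of [e] and can replace [e] in one
    matching. *)
Lemma cnt_le2 e : cnt M e <= 2.
Proof.
rewrite leqNgt; apply/negP => e3.
have eM i : i < 3 -> e \in M i.
  move: e3; rewrite /cnt /cover_count; case: i => [|[|[|i]]] // + _;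
  by case: (e \in M 0); case: (e \in M 1); case: (e \in M 2).
have sub v : inc v e -> [set f | inc v f] :\ e \subset unc M.
  move=> ve; apply/subsetP => f; rewrite !inE -/(unc M) => /andP[nfe vf].
  suff : f \in unc M by rewrite inE.
  apply/uncP => i i3; apply: contra nfe => fi; apply/eqP.
  by apply: (@deg_le1_uniq _ _ src tgt (M i) v); rewrite ?M1 ?eM.
have card v : inc v e -> #|[set f | inc v f] :\ e| = 2.
  move=> ve; have := deg3 v; rewrite /deg (cardsD1 e) !inE ve => -[<-].
  by apply: eq_card => f; rewrite !inE.
have pe : inc (src e) e by rewrite /Defs.inc eqxx.
have [q nqp incE] := other_end noloop pe.
have qe : inc q e by rewrite incE eqxx orbT.
set P := [set f | inc (src e) f] :\ e; set Q := [set f | inc q f] :\ e.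
have [f fPQ] : exists f, f \in P :&: Q.
  apply/set0Pn; rewrite -card_gt0.
  have : #|P :|: Q| <= 3.
    by rewrite -unc3 subset_leq_card // subUset /P /Q !sub.
  by have := cardsUI P Q; rewrite /P /Q !card //; lia.
move: fPQ; rewrite !inE => /andP[/andP[nfe pf] /andP[_ qf]].
apply: (@alternating_swap 0 [set e] [set f]) => //.
- by rewrite sub1set eM.
- by move=> g /set1P->; exists 1; rewrite eM.
- by rewrite sub1set; apply: (subsetP (sub _ pe)); rewrite !inE nfe.
- by apply/set0Pn; exists f; rewrite inE.
move=> v; rewrite !degE !big_set1 incE.
by rewrite (@inc_pair f (src e) q) // eq_sym.
Qed.

Definition doubly : {set E} := [set e | cnt M e == 2].

Lemma deg_sum (X : {set E}) v : deg X v = \sum_e inc v e * (e \in X).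
Proof.
rewrite degE big_mkcond /=; apply: eq_bigr => e _.
by case: (e \in X); rewrite ?muln1 ?muln0.
Qed.

Lemma deg_cnt v : \sum_e inc v e * cnt M e = 3.
Proof.
transitivity (deg (M 0) v + deg (M 1) v + deg (M 2) v); last by rewrite !M1.
rewrite !deg_sum -!big_split; apply: eq_bigr => e _.
by rewrite /cnt /cover_count !mulnDr.
Qed.

(** The three edges at [v] have cover counts summing to 3. As no count exceeds 2, counts of 2
    balance counts of 0. *)
Lemma deg_doubly v : deg doubly v = deg (unc M) v.
Proof.
apply/eqP; rewrite -(eqn_add2l 3) -{1}(deg3 v) -(deg_cnt v) !deg_sum -!big_split.
apply/eqP/eq_bigr => e _ /=; rewrite -!mulnDr !inE -/(cnt M e).
by have := cnt_le2 e; move: (cnt M e) => [|[|[|]]].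
Qed.

Lemma deg_unc_le1 v : deg (unc M) v <= 1.
Proof.
suff: 2 * deg (unc M) v <= 3 by lia.
rewrite -deg_doubly -(deg_cnt v) deg_sum big_distrr /= leq_sum // => e _.
by rewrite mulnCA leq_mul2l !inE; case: (cnt M e =P 2) => [->|]; rewrite ?orbT ?muln0 ?orbT.
Qed.

Lemma core_deg v : v \in core_vertices src tgt (M 0) (M 1) (M 2) ->
  0 < deg (unc M) v.
Proof.
rewrite inE => /existsP[e /andP[+ ve]]; rewrite inE -/(cnt M e) => ne1.
have [eU|nU] := boolP (e \in unc M); first exact: deg_gt0 eU ve.
rewrite -deg_doubly; apply: (@deg_gt0 _ _ _ _ doubly e) => //.
move: nU ne1; rewrite !inE -/(cnt M e).
by have := cnt_le2 e; move: (cnt M e) => [|[|[|]]].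
Qed.

Lemma doublyP e : e \in doubly ->
  exists2 m, m < 3 & forall i, i < 3 -> (e \in M i) = (i != m).
Proof.
rewrite inE /cnt /cover_count => e2.
suff [m /and4P[m3 /eqP e0 /eqP e1 /eqP e2']] : exists m,
    [&& m < 3, (e \in M 0) == (0 != m), (e \in M 1) == (1 != m) &
        (e \in M 2) == (2 != m)].
  by exists m => // -[|[|[|i]]].
case: (e \in M 0) e2; case: (e \in M 1); case: (e \in M 2) => // _.
- by exists 2.
- by exists 1.
by exists 0.
Qed.

Lemma doubly_in2 e i : e \in doubly -> exists l, [/\ l < 3, l != i & e \in M l].
Proof.
case/doublyP => m m3 eM.
have [l [l3 li lm]] : exists l, [/\ l < 3, l != i & l != m].
  exists (if (0 != i) && (0 != m) then 0 else
          if (1 != i) && (1 != m) then 1 else 2).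
  by case: i m m3 {eM} => [|[|[|i]]] [|[|[|m]]].
by exists l; rewrite eM.
Qed.

Lemma doubly_common e f : e \in doubly -> f \in doubly ->
  exists i, [/\ i < 3, e \in M i & f \in M i].
Proof.
case/doublyP => m m3 eM /doublyP[n n3 fM].
have [l [l3 lm ln]] : exists l, [/\ l < 3, l != m & l != n].
  exists (if (0 != n) && (0 != m) then 0 else
          if (1 != n) && (1 != m) then 1 else 2).
  by case: n m n3 m3 {eM fM} => [|[|[|n]]] [|[|[|m]]].
by exists l; rewrite eM ?fM.
Qed.

Definition hexagonal (u : nat -> V) (h : nat -> E) : Prop :=
  [/\ forall j k, j < 6 -> k < 6 -> u j = u k -> j = k,
      forall k, k < 6 ->
        forall x, inc x (h k) = (x == u k) || (x == u (k.+1 %% 6)),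
      forall k, k < 6 -> odd k -> h k \in unc M,
      forall k, k < 6 -> ~~ odd k -> h k \in doubly &
      forall e, e \in unc M -> exists2 k, k < 6 & e = h k].

(** Uncovered and doubly covered edges alternate along disjoint cycles. Cycles of length 2 and 4
    fall to [alternating_swap], which leaves a single 6-cycle through the three uncovered edges. It
    is oriented so that [h 1] is the uncovered edge at [v]. *)
Lemma hexagon_through v : 0 < deg (unc M) v ->
  exists u h, u 1 = v /\ hexagonal u h.
Proof.
have Uu x e f : e \in unc M -> inc x e -> f \in unc M -> inc x f -> e = f.
  by move=> *; apply: (deg_le1_uniq (deg_unc_le1 x)).
have Du x e f : e \in doubly -> inc x e -> f \in doubly -> inc x f -> e = f.
  by move=> *; apply: (@deg_le1_uniq _ _ src tgt doubly x);
     rewrite ?deg_doubly ?deg_unc_le1.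
have Uex x e : e \in doubly -> inc x e -> exists2 f, f \in unc M & inc x f.
  by move=> eD xe; apply: deg_gt0_ex; rewrite -deg_doubly (deg_gt0 eD).
have Dex x e : e \in unc M -> inc x e -> exists2 f, f \in doubly & inc x f.
  by move=> eU xe; apply: deg_gt0_ex; rewrite deg_doubly (deg_gt0 eU).
have oe x e : inc x e -> exists2 w, w != x & forall y, inc y e = (y == x) || (y == w).
  exact: other_end.
set u1 := v => /deg_gt0_ex[z1 z1U i1z1].
have [d0 d0D i1d0] := Dex _ _ z1U i1z1.
have [u0 n01 id0] := oe _ _ i1d0.
have [u2 n21 iz1] := oe _ _ i1z1.
have i0d0 : inc u0 d0 by rewrite id0 eqxx orbT.
have i2z1 : inc u2 z1 by rewrite iz1 eqxx orbT.
have n20 : u2 != u0.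
  apply/eqP => e20; have [i [i3 d0i _]] := doubly_common d0D d0D.
  apply: (@alternating_swap i [set d0] [set z1]) => //.
  - by rewrite sub1set.
  - by move=> g /set1P->; apply: doubly_in2.
  - by rewrite sub1set.
  - by apply/set0Pn; exists z1; rewrite inE.
  by move=> x; rewrite !degE !big_set1 id0 iz1 e20.
have [z5 z5U i0z5] := Uex _ _ d0D i0d0.
have [u5 n50 iz5] := oe _ _ i0z5.
have i5z5 : inc u5 z5 by rewrite iz5 eqxx orbT.
have nz51 : z5 != z1.
  apply/eqP => ez; move: i0z5; rewrite ez iz1.
  by rewrite (negPf n01) eq_sym (negPf n20).
have n51 : u5 != u1.
  by apply: contraNneq nz51 => e51; apply/eqP/(Uu u1); rewrite // -e51.
have n52 : u5 != u2.
  by apply: contraNneq nz51 => e52; apply/eqP/(Uu u2); rewrite // -e52.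
have [d2 d2D i2d2] := Dex _ _ z1U i2z1.
have [u3 n32 id2] := oe _ _ i2d2.
have i3d2 : inc u3 d2 by rewrite id2 eqxx orbT.
have nd20 : d2 != d0.
  by apply/eqP => ed; move: i2d2; rewrite ed id0 (negPf n20) (negPf n21).
have n31 : u3 != u1.
  by apply: contraNneq nd20 => e31; apply/eqP/(Du u1); rewrite // -e31.
have n30 : u3 != u0.
  by apply: contraNneq nd20 => e30; apply/eqP/(Du u0); rewrite // -e30.
(* Equality would close the 4-cycle [d0], [z1], [d2], [z5]; some matching contains both [d0] and
   [d2], and they can be traded for [z1] and [z5]. *)
have n35 : u3 != u5.
  apply/eqP => e35; have [i [i3 d0i d2i]] := doubly_common d0D d2D.
  apply: (@alternating_swap i [set d0; d2] [set z1; z5]) => //.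
  - by rewrite subUset !sub1set d0i.
  - by move=> g /set2P[]->; apply: doubly_in2.
  - by rewrite subUset !sub1set z1U.
  - by apply/set0Pn; exists z1; rewrite !inE eqxx.
  move=> x; rewrite !deg_setU1 ?inE 1?eq_sym // !degE !big_set1.
  rewrite id0 id2 iz1 iz5 e35.
  have [->|_] := eqVneq x u0.
    by rewrite (negPf n01) ![u0 == _]eq_sym (negPf n20) (negPf n50).
  have [->|_] := eqVneq x u1.
    by rewrite ![u1 == _]eq_sym (negPf n21) (negPf n51).
  by have [->|_] := eqVneq x u2; rewrite ?addn0 // eq_sym (negPf n52).
have [d4 d4D i5d4] := Dex _ _ z5U i5z5.
have [u4 n45 id4] := oe _ _ i5d4.
have i4d4 : inc u4 d4 by rewrite id4 eqxx orbT.
have nd40 : d4 != d0.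
  by apply/eqP => ed; move: i5d4; rewrite ed id0 (negPf n50) (negPf n51).
have nd42 : d4 != d2.
  by apply/eqP => ed; move: i5d4; rewrite ed id2 (negPf n52) eq_sym (negPf n35).
have n40 : u4 != u0.
  by apply: contraNneq nd40 => e4; apply/eqP/(Du u0); rewrite // -e4.
have n41 : u4 != u1.
  by apply: contraNneq nd40 => e4; apply/eqP/(Du u1); rewrite // -e4.
have n42 : u4 != u2.
  by apply: contraNneq nd42 => e4; apply/eqP/(Du u2); rewrite // -e4.
have n43 : u4 != u3.
  by apply: contraNneq nd42 => e4; apply/eqP/(Du u3); rewrite // -e4.
have [z3 z3U i3z3] := Uex _ _ d2D i3d2.
have [z3' z3'U i4z3'] := Uex _ _ d4D i4d4.
have nz31 : z3 != z1.
  by apply/eqP => ez; move: i3z3; rewrite ez iz1 (negPf n31) (negPf n32).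
have nz35 : z3 != z5.
  by apply/eqP => ez; move: i3z3; rewrite ez iz5 (negPf n30) (negPf n35).
(* These exhaust the uncovered edges, so the one at [u4] must be [z3], which closes the hexagon. *)
have eU : unc M = [set z1; z3; z5].
  apply/esym/eqP; rewrite eqEcard unc3 !subUset !sub1set z1U z3U z5U /=.
  by rewrite -setUA !cardsU1 !inE cards1 negb_or (eq_sym z1) nz31 (eq_sym z1) nz51 nz35.
have i4z3 : inc u4 z3.
  move: (z3'U); rewrite eU !inE => /orP[/orP[]|] /eqP ez; first last.
  - by move: i4z3'; rewrite ez iz5 (negPf n40) (negPf n45).
  - by rewrite -ez.
  by move: i4z3'; rewrite ez iz1 (negPf n41) (negPf n42).
have iz3 := @inc_pair z3 u3 u4 _ i3z3 i4z3.
exists (nth u0 [:: u0; u1; u2; u3; u4; u5]), (nth z1 [:: d0; z1; d2; z3; d4; z5]).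
split=> //; split.
- move=> j k j6 k6 /eqP; rewrite nth_uniq //; first by move/eqP.
  rewrite /= !inE !negb_or n01 ![u0 == _]eq_sym n20 n30 n40 n50.
  rewrite ![u1 == _]eq_sym n21 n31 n41 n51 ![u2 == _]eq_sym n32 n42 n52.
  by rewrite [u3 == u4]eq_sym n43 n35 n45.
- move=> k + x; do 6?[case: k => [|k]] => //= _.
  + by rewrite id0 orbC.
  + by rewrite iz3 // eq_sym.
  + by rewrite id4 orbC.
  by rewrite iz5 orbC.
- by do 6?[case=> [|] //].
- by do 6?[case=> [|] //].
move=> e; rewrite eU !inE => /orP[/orP[]|] /eqP->.
- by exists 1.
- by exists 3.
by exists 5.
Qed.

(** A matching containing all three doubly covered edges could trade them for the three uncovered
    ones. Hence each matching misses one of them, and [m] permutes the indices. *)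
Lemma hexagon_missing u h : hexagonal u h ->
  exists2 m : nat -> nat,
    (forall i, i < 3 -> m i < 3) /\
    (forall i j, i < 3 -> j < 3 -> m i = m j -> i = j) &
    forall i k, i < 3 -> k < 3 -> (h k.*2 \in M i) = (i != m k).
Proof.
case=> uI incH hU hD UE.
have [m0 m03 hm0] := doublyP (hD 0 isT isT).
have [m2 m23 hm2] := doublyP (hD 2 isT isT).
have [m4 m43 hm4] := doublyP (hD 4 isT isT).
have noi i : i < 3 -> [&& i != m0, i != m2 & i != m4] -> False.
  move=> i3 /and3P[i0 i2 i4].
  apply: (@alternating_swap i (hexagon_edges h (fun k => ~~ odd k))
                              (hexagon_edges h odd)) => //.
  - apply/subsetP => e /hexagon_edgesP[k [k6 + ->]].
    by move: k k6; do 6?[case=> [|] //] => _ _; rewrite ?hm0 ?hm2 ?hm4.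
  - move=> e /hexagon_edgesP[k [k6 ok ->]].
    by apply: doubly_in2; apply: hD.
  - by apply/subsetP => e /hexagon_edgesP[k [k6 ok ->]]; apply: hU.
  - by apply/set0Pn; exists (h 1); apply/hexagon_edgesP; exists 1.
  move=> v; have [[k k6 ->]|nv] := vertex_hexagonP u v; last first.
    by rewrite !(deg_hexagon_edges_out uI incH).
  rewrite !(deg_hexagon_edges uI incH) //.
  by move: k k6; do 6?[case=> [|] //].
exists (nth 0 [:: m0; m2; m4]).
  split; first by do 3?[case=> [|] //].
  have := noi 0 isT; have := noi 1 isT; have := noi 2 isT => n2 n1 n0.
  by do 3?[case=> [|] //]; do 3?[case=> [|] //] => /= _ _ e; exfalso;
    move: n0 n1 n2; rewrite ?e; lia.
by move=> i [|[|[|k]]] // i3 _; rewrite ?hm0 ?hm2 ?hm4.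
Qed.

End Core.

(** * Triangles meeting the core *)

Section Snark.

Variables (V E : finType) (src tgt : E -> V).

Local Notation inc := (inc src tgt).
Local Notation deg := (deg src tgt).

(** * Adjacency, loops and degrees in cubic graphs *)

Lemma adj_edge x y : adj src tgt x y ->
  x != y /\ exists e, (src e == x) && (tgt e == y) || (src e == y) && (tgt e == x).
Proof. by case/andP => nxy /existsP[e exy]; split=> //; exists e. Qed.

Lemma adj_inc x y : adj src tgt x y -> x != y /\ exists e, inc x e /\ inc y e.
Proof.
case/adj_edge => nxy [e exy]; split=> //; exists e; rewrite /Defs.inc.
by case/orP: exy => /andP[-> ->]; rewrite ?orbT.
Qed.

Lemma adjC x y : adj src tgt x y = adj src tgt y x.
Proof.
by rewrite /adj eq_sym; congr (_ && _); apply: eq_existsb => e; rewrite orbC.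
Qed.

(** A loop takes two of the three edge ends at its vertex, so only one edge leaves it. *)
Lemma loop_adj_uniq e x y : cubic src tgt -> is_loop src tgt e ->
  adj src tgt (src e) x -> adj src tgt (src e) y -> x = y.
Proof.
move=> c3 /eqP le /adj_edge[nx [f fx]] /adj_edge[ny [g gy]].
set p := src e in nx fx ny gy *.
pose S := [set a | src a == p]; pose T := [set a | tgt a == p].
have d3 : #|S| + #|T| = 3 := c3 p.
have eS : e \in S by rewrite inE.
have eT : e \in T by rewrite inE -le.
have nfe : f != e.
  by apply: contraNneq nx => fe; move: fx; rewrite fe -le -/p; case/orP => /andP[].
have nge : g != e.
  by apply: contraNneq ny => ge; move: gy; rewrite ge -le -/p; case/orP => /andP[].
have fST : (f \in S) || (f \in T)
  by rewrite !inE; case/orP: fx => /andP[e1 e2]; rewrite ?e1 ?e2 ?orbT.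
have gST : (g \in S) || (g \in T)
  by rewrite !inE; case/orP: gy => /andP[e1 e2]; rewrite ?e1 ?e2 ?orbT.
have [fg|nfg] := eqVneq f g.
  move: gy nx ny; rewrite -fg.
  by case/orP: fx => /andP[/eqP-> /eqP->] /orP[]/andP[/eqP e1 /eqP e2];
    rewrite ?e1 ?e2 ?eqxx.
exfalso; move: d3; rewrite (cardsD1 e S) (cardsD1 e T) eS eT /= => d3.
have sub : [set f; g] \subset (S :\ e) :|: (T :\ e).
  by rewrite subUset !sub1set !in_setU !in_setD1 nfe nge fST gST.
have := subset_leq_card sub; rewrite cards2 nfg.
by move: (cardsUI (S :\ e) (T :\ e)) d3; clear; lia.
Qed.

(** The only neighbour of a vertex with a loop would be a cut vertex, separating it from a third
    vertex. *)
Lemma two_connected_noloop : two_connected src tgt -> cubic src tgt ->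
  forall e, ~~ is_loop src tgt e.
Proof.
case=> V2 con con2 c3 e; apply/negP => le; set p := src e.
have ex2 q : exists y, y \notin [set p; q].
  apply/existsP; rewrite -negb_forall; apply/negP => /forallP all.
  have : [set: V] \subset [set p; q] by apply/subsetP => y _; apply: all.
  by move/subset_leq_card; rewrite cardsT cards2 => /(leq_trans V2); case: (p != q).
have step (r : rel V) x y : connect r x y -> x != y -> exists z, r x z.
  case/connectP => -[|z s] /= => [_ ->|/andP[xz _] _]; first by rewrite eqxx.
  by exists z.
have [y] := ex2 p; rewrite !inE orbb eq_sym => npy.
have [q pq] := step _ _ _ (con p y) npy.
have [z] := ex2 q; rewrite !inE negb_or eq_sym => /andP[npz nzq].
have npq : p != q by case/andP: pq.
have [r /and3P[pr _ nrq]] := step _ _ _ (con2 q p z npq nzq) npz.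
by move: nrq; rewrite (loop_adj_uniq c3 le pr pq) eqxx.
Qed.

Lemma cubic_deg : (forall e, ~~ is_loop src tgt e) -> cubic src tgt ->
  forall v, deg setT v = 3.
Proof.
move=> nl c3 v; rewrite -(c3 v) /degree -cardsUI.
rewrite [X in _ + X](_ : _ = 0) ?addn0; last first.
  apply/eqP; rewrite cards_eq0 -subset0; apply/subsetP => e; rewrite !inE.
  by case/andP => /eqP se /eqP te; have := nl e; rewrite /is_loop se te eqxx.
by apply: eq_card => e; rewrite !inE.
Qed.

Lemma perfect_matchingP M : (forall e, ~~ is_loop src tgt e) ->
  perfect_matching src tgt M <-> forall v, deg M v = 1.
Proof. by move=> nl; split=> [[]|]. Qed.

(** * Edges leaving the hexagon and the position of the triangle *)

Section Triangle.

Hypothesis noloop : forall e, ~~ is_loop src tgt e.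

Variables (M : nat -> {set E}) (u : nat -> V) (h : nat -> E) (m : nat -> nat).
Hypothesis M1 : forall i, i < 3 -> forall v, deg (M i) v = 1.
Hypothesis hexuh : hexagonal src tgt M u h.
Hypothesis m3 : forall i, i < 3 -> m i < 3.
Hypothesis m_inj : forall i j, i < 3 -> j < 3 -> m i = m j -> i = j.
Hypothesis hM : forall i k, i < 3 -> k < 3 -> (h k.*2 \in M i) = (i != m k).

Let u_inj : forall j k, j < 6 -> k < 6 -> u j = u k -> j = k.
Proof. by case: hexuh. Qed.

Let inc_h : forall k, k < 6 ->
  forall x, inc x (h k) = (x == u k) || (x == u (k.+1 %% 6)).
Proof. by case: hexuh. Qed.

(** Renumbering through [m] makes colour [i] stand for [M (m i)], the matching that misses
    [h i.*2]. *)
Lemma hM_even i k : i < 3 -> k < 6 -> ~~ odd k -> (h k \in M (m i)) = (k./2 != i).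
Proof.
move=> i3 k6 ek; have {1}-> : k = k./2.*2 by rewrite even_halfK.
rewrite hM ?m3 //; last by move: k k6 {ek}; do 6?[case=> [|] //].
rewrite eq_sym; congr (~~ _); apply/eqP/eqP => [/m_inj->|->] //.
by move: k k6 {ek}; do 6?[case=> [|] //].
Qed.

Lemma m_surj l : l < 3 -> exists2 i, i < 3 & l = m i.
Proof.
move=> l3; have := m3 (isT : 0 < 3); have := m3 (isT : 1 < 3); have := m3 (isT : 2 < 3).
have n01 : m 0 <> m 1 by move/m_inj => /(_ isT isT).
have n02 : m 0 <> m 2 by move/m_inj => /(_ isT isT).
have n12 : m 1 <> m 2 by move/m_inj => /(_ isT isT).
move=> m23 m13 m03; have : l = m 0 \/ l = m 1 \/ l = m 2 by lia.
by case=> [|[]] ->; [exists 0 | exists 1 | exists 2].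
Qed.

Lemma nonhexagon_covered e : (forall k, k < 6 -> e != h k) ->
  exists2 i, i < 3 & e \in M (m i).
Proof.
move=> ne; have : e \notin unc M.
  case: hexuh => _ _ _ _ UE; apply/negP => /UE[k k6 ek].
  by have := ne k k6; rewrite ek eqxx.
suff : e \notin unc M -> exists2 l, l < 3 & e \in M l.
  by move=> + nU => /(_ nU)[l /m_surj[i i3 ->]]; exists i.
rewrite inE /cover_count; case e0: (e \in M 0); first by exists 0.
case e1: (e \in M 1); first by exists 1.
by case e2: (e \in M 2); first by exists 2.
Qed.

(** The doubly covered hexagon edge at [u k] is [h k./2.*2]. It occupies both colours other than
    [k./2], so an edge leaving there has colour [k./2]. *)
Lemma outer_edge_half e k i : k < 6 -> i < 3 -> inc (u k) e ->
  (forall j, j < 6 -> e != h j) -> e \in M (m i) -> k./2 = i.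
Proof.
move=> k6 i3 ke ne ei; apply/eqP/negPn/negP => nki.
have [j [j6 ej jk kj]] :
    exists j, [/\ j < 6, ~~ odd j, j./2 = k./2 & inc (u k) (h j)].
  have k6' : k./2.*2 < 6 by move: k6; clear; lia.
  exists k./2.*2; rewrite odd_double doubleK inc_h // !(eq_u u_inj) ?ltn_mod //.
  by split=> //; move: k k6 {ke nki k6'}; do 6?[case=> [|] //].
have hj : h j \in M (m i) by rewrite hM_even // jk.
have := deg_le1_uniq _ ei ke hj kj; rewrite M1 ?m3 // => /(_ isT) ehj.
by have := ne j j6; rewrite ehj eqxx.
Qed.

Lemma outer_edge_class e k : k < 6 -> inc (u k) e ->
  (forall j, j < 6 -> e != h j) -> e \in M (m k./2).
Proof.
move=> k6 ke ne; have [i i3 ei] := nonhexagon_covered ne.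
by rewrite (outer_edge_half k6 i3 ke ne ei).
Qed.

(** The colour of a chord can be read off at either end, so a chord can only join the two ends of a
    doubly covered edge. *)
Lemma outer_chord_half e j k : j < 6 -> k < 6 -> inc (u j) e -> inc (u k) e ->
  (forall l, l < 6 -> e != h l) -> j./2 = k./2.
Proof.
move=> j6 k6 je ke ne; apply: (outer_edge_half j6 _ je ne).
  by move: k6; clear; lia.
exact: outer_edge_class ke ne.
Qed.

Lemma outer_edge_uniq e f k x : k < 6 -> inc (u k) e ->
  (forall j, j < 6 -> e != h j) -> inc x e ->
  forall l, l < 6 -> l./2 = k./2 -> inc (u l) f ->
  (forall j, j < 6 -> f != h j) -> inc x f -> e = f.
Proof.
move=> k6 ke ne xe l l6 lk lf nf xf.
apply: (@deg_le1_uniq _ _ src tgt (M (m k./2)) x) => //.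
- by rewrite M1 // m3 //; lia.
- exact: outer_edge_class ke ne.
by rewrite -lk; apply: outer_edge_class lf nf.
Qed.

Lemma inc_u_h j k : j < 6 -> k < 6 ->
  inc (u j) (h k) = (j == k) || (j == k.+1 %% 6).
Proof. by move=> j6 k6; rewrite inc_h // !(eq_u u_inj) ?ltn_mod. Qed.

Lemma three_ends x y z e :
  x != y -> x != z -> y != z -> inc x e -> inc y e -> inc z e -> False.
Proof.
move=> nxy nxz nyz xe ye ze; have := inc_pair noloop nxy xe ye z.
by rewrite ze ![z == _]eq_sym (negPf nxz) (negPf nyz).
Qed.

Definition triangle_on_uncovered : Prop :=
  exists x f g, [/\ forall k, k < 6 -> x != u k,
    forall y, inc y f = (y == u 1) || (y == x) &
    forall y, inc y g = (y == u 2) || (y == x)].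

(** As [e2] leaves the hexagon at [u 1], [e1] is a hexagon edge. It is not the doubly covered [h 0],
    since the leaving edges at [u 0] and [u 1] share a colour and cannot meet at [q]. So it is
    [h 1]. *)
Lemma triangle_outer_edge p q e1 e2 e3 :
  p != u 1 -> q != u 1 -> p != q ->
  inc (u 1) e1 -> inc p e1 -> inc (u 1) e2 -> inc q e2 -> inc p e3 -> inc q e3 ->
  (forall j, j < 6 -> e2 != h j) -> triangle_on_uncovered.
Proof.
move=> np nq npq e11 pe1 e21 qe2 pe3 qe3 n2.
have [[k k6 e1E]|n1] := edge_hexagonP h e1; last first.
  have e12 := outer_edge_uniq (isT : 1 < 6) e11 n1 e11 (isT : 1 < 6) erefl e21 n2 e21.
  exfalso; apply: (@three_ends (u 1) p q e1) => //; rewrite 1?eq_sym //.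
  by rewrite e12.
have n1u k' : k' < 6 -> k' != 1 -> u k' != u 1.
  by move=> k'6 nk; rewrite (eq_u u_inj).
have nqh k' : k' < 6 -> 1 < k' -> q != u k'.
  move=> k'6 k'1; apply/eqP => qk; move: qe2; rewrite qk => k'e2.
  have := outer_chord_half (isT : 1 < 6) k'6 e21 k'e2 n2.
  by move: k' k'1 {k'6 qk k'e2}; do 2?[case=> [|] //].
rewrite e1E in e11 pe1; move: pe1; rewrite inc_h //.
move: e11; rewrite inc_u_h //.
move: k k6 {e1E}; do 2?[case=> [|] //]; last by do 4?[case=> [|] //].
  move=> _ _ /orP[]/eqP pE; last by rewrite pE eqxx in np.
  exfalso; rewrite pE in pe3 npq np.
  have [[l l6 e3E]|n3] := edge_hexagonP h e3.
    rewrite e3E in pe3 qe3; move: pe3 qe3; rewrite inc_u_h // inc_h //.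
    move: l l6 {e3E}; do 6?[case=> [|] //] => _ _ /=.
      by rewrite (negPf nq) orbF eq_sym (negPf npq).
    by rewrite (negPf (nqh 5 _ _)) // eq_sym (negPf npq).
  have e23 := outer_edge_uniq (isT : 1 < 6) e21 n2 qe2 (isT : 0 < 6) erefl pe3 n3 qe3.
  by apply: (@three_ends (u 0) (u 1) q e2) => //; rewrite ?e23 // eq_sym.
move=> _ _ /orP[]/eqP pE; first by rewrite pE eqxx in np.
rewrite pE /= in pe3 npq np.
have n3 j : j < 6 -> e3 != h j.
  move=> j6; apply/eqP => e3E; rewrite e3E in pe3 qe3.
  move: pe3 qe3; rewrite inc_u_h // inc_h //.
  move: j j6 {e3E}; do 6?[case=> [|] //] => _ _ /=.
    by rewrite (negPf nq) eq_sym (negPf npq).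
  by rewrite (negPf (nqh 3 _ _)) // eq_sym (negPf npq).
exists q, e2, e3; split.
- move=> k k6; have [k1|k1] := ltnP 1 k; first exact: nqh.
  apply/eqP => qk; rewrite qk in qe3.
  have := outer_chord_half k6 (isT : 2 < 6) qe3 pe3 n3.
  by move: k k1 {k6 qk qe3}; do 2?[case=> [|] //].
- by apply: inc_pair; rewrite // eq_sym.
by apply: inc_pair.
Qed.

(** If both triangle edges at [u 1] were on the hexagon, the third would join [u 0] to [u 2]; no
    hexagon edge does, and the colours exclude a chord. *)
Lemma triangle_through_u1 p q :
  adj src tgt (u 1) p -> adj src tgt (u 1) q -> adj src tgt p q ->
  triangle_on_uncovered.
Proof.
case/adj_inc => np [e1 [e11 pe1]] /adj_inc[nq [e2 [e21 qe2]]].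
case/adj_inc => npq [e3 [pe3 qe3]].
have [[j j6 e1E]|n1] := edge_hexagonP h e1; last first.
  by apply: (@triangle_outer_edge q p e2 e1 e3); rewrite // eq_sym.
have [[k k6 e2E]|n2] := edge_hexagonP h e2; last first.
  by apply: (@triangle_outer_edge p q e1 e2 e3); rewrite // eq_sym.
rewrite e1E in e11 pe1; rewrite e2E in e21 qe2.
have other l x : l < 6 -> u 1 != x -> inc (u 1) (h l) -> inc x (h l) ->
    l = 0 /\ x = u 0 \/ l = 1 /\ x = u 2.
  move=> l6 nx; rewrite inc_u_h // inc_h //; move: l l6.
  do 6?[case=> [|] //] => _ _ /=; rewrite [x == u 1]eq_sym (negPf nx) ?orbF => /eqP->.
    by left.
  by right.
exfalso.
have ends : inc (u 0) e3 /\ inc (u 2) e3.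
  have [[_ pE]|[_ pE]] := other _ _ j6 np e11 pe1;
  have [[_ qE]|[_ qE]] := other _ _ k6 nq e21 qe2;
  by move: npq pe3 qe3; rewrite pE qE ?eqxx.
case: ends => e30 e32.
have [[l l6 e3E]|n3] := edge_hexagonP h e3; last first.
  by have := outer_chord_half (isT : 0 < 6) (isT : 2 < 6) e30 e32 n3.
move: e30 e32; rewrite e3E !inc_u_h //.
by move: l l6 {e3E}; do 6?[case=> [|] //].
Qed.

Lemma outer_colouring_of_array :
  exists X, outer_colouring src tgt u h X [:: 0; 0; 1; 1; 2; 2].
Proof.
have [_ _ hU _ _] := hexuh.
(* [B i] selects the doubly covered hexagon edges contained in [M (m i)]. *)
pose B i k := ~~ odd k && (k./2 != i).
exists (fun i => M (m i) :\: hexagon_edges h (B i)).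
have sub i : i < 3 -> hexagon_edges h (B i) \subset M (m i).
  move=> i3; apply/subsetP => e /hexagon_edgesP[k [k6 /andP[ek ki] ->]].
  by rewrite hM_even.
split.
- move=> i k i3 k6; have := deg_setD src tgt (u k) (sub i i3).
  rewrite M1 ?m3 // (deg_hexagon_edges u_inj inc_h) // /B.
  by move: i k i3 k6 {sub}; do 3?[case=> [|] //];
     do 6?[case=> [|] //] => _ _ /=; lia.
- move=> i v i3 nv; have := deg_setD src tgt v (sub i i3).
  by rewrite M1 ?m3 // (deg_hexagon_edges_out u_inj inc_h) // add0n.
- move=> i k i3 k6; rewrite in_setD; have [ok|ek] := boolP (odd k).
    apply/nandP; right; have := hU k k6 ok.
    by move/(elimT (uncP M _)); apply; apply: m3.
  rewrite hM_even //; have [_|nki] := eqVneq k./2 i; first by rewrite andbF.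
  by rewrite andbT negbK; apply/hexagon_edgesP; exists k; rewrite /B ek.
move=> e ne; have [i i3 ei] := nonhexagon_covered ne.
exists i; rewrite // in_setD ei andbT; apply/hexagon_edgesP => -[k [k6 _ ek]].
by have := ne k k6; rewrite ek eqxx.
Qed.

End Triangle.

Lemma array_cover_deg3 j (Ms : 'I_j -> {set E}) :
  0 < #|E| -> (forall i, perfect_matching src tgt (Ms i)) ->
  (forall e, exists i, e \in Ms i) -> j < 4 ->
  exists N : nat -> {set E},
    (forall i, perfect_matching src tgt (N i)) /\ unc N = set0.
Proof.
case: j Ms => [|j] Ms /card_gt0P[e0 _] pM cM j4; first by case: (cM e0) => -[].
(* Out of range [inord] returns 0, so a shorter family is padded with copies of its first
   matching. *)
exists (fun i => Ms (inord i)); split=> //.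
apply/setP => e; rewrite in_set0; apply/negP => /uncP eN.
have [i ei] := cM e; have /negP[] := eN i (leq_trans (ltn_ord i) (j4 : j.+1 <= 3)).
by rewrite inord_val.
Qed.

End Snark.

Theorem theorem5p4 (V E : finType) (src tgt : E -> V) :
  snark src tgt ->
  colouring_defect_is src tgt 3 ->
  (exists M1 M2 M3 : {set E},
     optimal_array src tgt M1 M2 M3 /\
     exists a b c : V, triangle src tgt a b c /\
       [set a; b; c] :&: core_vertices src tgt M1 M2 M3 != set0) ->
  pm_index_is src tgt 4.
Proof.
case=> con2 c3 _ [[A1 [A2 [A3 [arrA cardA]]]] min3].
have nl := two_connected_noloop con2 c3.
have d3 := cubic_deg nl c3.
have pmP N := perfect_matchingP N nl.
have unc_min (N : nat -> {set E}) :
    (forall i, i < 3 -> forall v, deg src tgt (N i) v = 1) -> 3 <= #|unc N|.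
  by move=> N1; apply: min3; split; apply/pmP => v; apply: N1.
case=> M1 [M2 [M3 [[[pM1 pM2 pM3] optM] [a [b [c [[ab bc ac] tri]]]]]]].
pose M := nth M3 [:: M1; M2; M3].
have M_deg i : i < 3 -> forall v, deg src tgt (M i) v = 1.
  by case: i => [|[|[|i]]] // _; apply/pmP.
have unc3 : #|unc M| = 3.
  by apply/eqP; rewrite eqn_leq unc_min // andbT -[X in _ <= X]cardA optM.
(* Fewer than four matchings covering all edges would yield a 3-array without uncovered edges,
   against defect 3. *)
split; last first.
  move=> j j4 [Ms [pMs cMs]].
  have E0 : 0 < #|E|.
    have [V2 _ _] := con2; have /card_gt0P[v _] : 0 < #|V| by apply: leq_trans V2.
    have [e _ _] : exists2 e, e \in setT & Defs.inc src tgt v e.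
      by apply: deg_gt0_ex; rewrite d3.
    by apply/card_gt0P; exists e.
  have [N [pN N0]] := array_cover_deg3 E0 pMs cMs j4.
  have := unc_min N; rewrite N0 cards0 => H; suff: 3 <= 0 by [].
  by apply: H => i _; apply/pmP.
have [v vT vC] : exists2 v, v \in [set a; b; c] &
    v \in core_vertices src tgt M1 M2 M3.
  by case/set0Pn: tri => v /setIP[]; exists v.
have [u [h [u1 hex]]] :=
  hexagon_through nl d3 M_deg unc3 unc_min (core_deg nl d3 M_deg unc3 unc_min vC).
have [m [m3 m_inj] hM] := hexagon_missing M_deg unc3 unc_min hex.
have [x [f [g [nx incf incg]]]] : triangle_on_uncovered src tgt u.
  have T := triangle_through_u1 nl M_deg hex m3 m_inj hM; rewrite u1 in T.
  move: vT; rewrite !inE => /orP[/orP[]|] /eqP ev; rewrite ev in T.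
  - exact: (T b c).
  - by apply: (T a c); rewrite // adjC.
  by apply: (T a b); rewrite // adjC.
have [X cX] := outer_colouring_of_array M_deg hex m3 m_inj hM.
have [u_inj inc_h _ hD hE] := hex.
have no_cover (N : nat -> {set E}) :
    (forall i, i < 3 -> forall v, deg src tgt (N i) v = 1) ->
    ~ (forall e, exists2 i, i < 3 & e \in N i).
  move=> N1 cN; have := unc_min N N1; rewrite [unc N](_ : _ = set0) ?cards0 //.
  apply/setP => e; rewrite in_set0; apply/negP => /uncP eN.
  by have [i i3 ei] := cN e; have := eN i i3; rewrite ei.
have [N [N1 N_1 N_3 N_5]] :=
  matching_through_uncovered nl u_inj inc_h no_cover cX nx incf incg.
(* The default [N] of [nth] is the fourth matching, reached at index 3; it contains all the
   uncovered edges. *)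
exists (fun i : 'I_4 => nth N [:: M1; M2; M3] i); split.
  by case=> -[|[|[|[|i]]]] //= _; apply/pmP.
move=> e; have [eU|] := boolP (e \in unc M).
  exists (Ordinal (isT : 3 < 4)) => /=.
  have [k k6 ek] := hE e eU; rewrite ek in eU *.
  have [ok|ek2] := boolP (odd k); first by move: k k6 ok {ek eU}; do 6?[case=> [|] //].
  by have := hD k k6 ek2; move: eU; rewrite !inE /cnt => /eqP->.
rewrite inE /cover_count /=; case e0: (e \in M1).
  by exists (Ordinal (isT : 0 < 4)).
case e1: (e \in M2); first by exists (Ordinal (isT : 1 < 4)).
by case e2: (e \in M3); first by exists (Ordinal (isT : 2 < 4)).
Qed.
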